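(* Let $\mathrm{BM}\subset\mathfrak{L}$ be the set of distributions of Brownian motions (with arbitrary drift and rate), i.e. of Lévy processes $Z$ with $\mathbb{E}[e^{iuZ_t}]=\exp\{iut\beta-u^2t\sigma^2/2\}$ for all $u\in\mathbb{R}$, $t\ge 0$, for some $\beta\in\mathbb{R}$, $\sigma^2\ge 0$. Then $\mathrm{BM}$ is good.
   Context: A Lévy process is a real-valued process $(Z_t)_{t\ge0}$ with stationary independent increments, continuous in probability, with $Z_0=0$. $\mathfrak{L}$ is the set of distributions (laws on $\mathbb{R}^{[0,\infty)}$ with the product $\sigma$-algebra) of Lévy processes, equipped with the smallest $\sigma$-algebra making the passage from a law to each of its one-time marginals measurable (as a map into the Borel probability measures on $\mathbb{R}$, with the $\sigma$-algebra generated by $\mu\mapsto\mu(B)$, $B$ Borel). A mixture of Lévy processes with mixing measure $\Theta$, a probability measure on $\mathfrak{L}$, is a process $S=(S_t)_{t\ge 0}$ such that $\mathbb{P}(S\in A)=\int_{\mathfrak{L}}\gamma(A)\,d\Theta(\gamma)$ for every product measurable $A\subset\mathbb{R}^{[0,\infty)}$. A measurable subset $L\subset\mathfrak{L}$ is good if whenever $S,T$ are mixtures of Lévy processes whose mixing measures $\Theta_1,\Theta_2$ are concentrated on $L$, and $S_t$ and $T_t$ have the same distribution for every $t\ge0$, then $S$ and $T$ have the same (joint) distribution. *)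

(* Defs.v *)
From HB Require Import structures.
From mathcomp Require Import all_boot all_order all_algebra.
From mathcomp Require Import complex.
From mathcomp Require Import all_classical all_reals all_analysis.

Set Implicit Arguments.
Unset Strict Implicit.
Unset Printing Implicit Defensive.

Import Order.TTheory GRing.Theory Num.Theory.
Import numFieldNormedType.Exports.

Local Open Scope classical_set_scope.
Local Open Scope ring_scope.
Local Open Scope complex_scope.

Section complex_expectation.
Context {R : realType}.

Definition cexp (z : R[i]) : R[i] :=
  (expR (complex.Re z))%:C * (cos (complex.Im z) +i* sin (complex.Im z)).

(* Meant for bounded f, for which both integrals are finite. *)
Definition cexpectation d (T : measurableType d) (P : probability T R)
    (f : T -> R[i]) : R[i] :=
  (\int[P]_w complex.Re (f w)) +i* (\int[P]_w complex.Im (f w)).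

End complex_expectation.

Section path_space.
Context (R : realType).

(* Cylinder sets over a single coordinate; they generate the product
   sigma-algebra. *)
Definition cylinders : set (set ({nonneg R} -> R)) :=
  \bigcup_t preimage_set_system setT (fun x : {nonneg R} -> R => x t)
    (@measurable _ R).

Definition path_space : measurableType cylinders.-sigma :=
  g_sigma_algebraType cylinders.

Definition coord (t : {nonneg R}) (x : path_space) : R := x t.

Lemma measurable_coord t : measurable_fun setT (coord t).
Proof.
move=> _ B mB; apply: sub_sigma_algebra; exists t => //.
by exists B.
Qed.

HB.instance Definition _ t :=
  isMeasurableFun.Build _ _ _ _ (coord t) (measurable_coord t).

End path_space.

Section processes.
Context {R : realType} {d} {T : measurableType d} (P : probability T R).

Definition mutually_independent (I : finType) (X : I -> T -> R) :=
  forall (J : {set I}) (B : I -> set R), (forall i, measurable (B i)) ->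
  P (\bigcap_(i in [set` J]) X i @^-1` B i) =
  (\prod_(i in J) P (X i @^-1` B i))%E.

Definition process := {nonneg R} -> {RV P >-> R}.

Definition trajectory (Z : process) (w : T) : path_space R := fun t => Z t w.

Definition stationary_increments (Z : process) :=
  forall (s t h : {nonneg R}) (B : set R), measurable B ->
  P [set w | B (Z (s%:num + h%:num)%:nng w - Z s w)] =
  P [set w | B (Z (t%:num + h%:num)%:nng w - Z t w)].

Definition independent_increments (Z : process) :=
  forall (n : nat) (t : nat -> {nonneg R}),
  (forall i j, (i <= j)%N -> (t i)%:num <= (t j)%:num) ->
  mutually_independent (fun (i : 'I_n) w => Z (t i.+1) w - Z (t i) w).

Definition continuous_in_probability (Z : process) :=
  forall (t : {nonneg R}) (e r : R), 0 < e -> 0 < r ->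
  exists2 delta : R, 0 < delta &
    forall s : {nonneg R}, `|s%:num - t%:num| < delta ->
      (P [set w | (e < `|Z s w - Z t w|)%R] <= r%:E)%E.

Definition levy_process (Z : process) :=
  [/\ forall w, Z 0%:nng w = 0,
      stationary_increments Z,
      independent_increments Z &
      continuous_in_probability Z].

Definition brownian_motion (Z : process) :=
  levy_process Z /\
  exists beta sigma2 : R, 0 <= sigma2 /\
    forall (u : R) (t : {nonneg R}),
      cexpectation P (fun w => cexp ('i * (u * Z t w)%:C)) =
      cexp ('i * (u * t%:num * beta)%:C - (u ^+ 2 * t%:num * sigma2 / 2)%:C).

Definition has_law (Z : process) (g : probability (path_space R) R) :=
  forall A, measurable A -> g A = P (trajectory Z @^-1` A).

End processes.

Section levy_laws.
Context (R : realType).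

(* A [probability] also takes (irrelevant) values on non-measurable sets, so a
   distribution has several representatives.  The sigma-algebra put on the set
   of laws below does not separate them. *)
Definition levy_laws : set (probability (path_space R) R) :=
  [set g | exists d (T : measurableType d) (P : probability T R)
     (Z : process P), levy_process Z /\ has_law Z g].

Definition levy_law : Type := levy_laws.

Lemma zero_levy_law : levy_laws (@dirac _ (path_space R) (fun=> 0) R).
Proof.
pose P : probability (path_space R) R :=
  @dirac _ (path_space R) (fun=> 0) R.
pose Z : process P := fun t => (cst 0 : {mfun path_space R >-> R}).
exists _, (path_space R), P, Z; split; last first.
  by move=> A mA; rewrite /P /= !diracE.
split => //.
- move=> n t _ J B mB; rewrite /= diracE.
  under eq_bigr do rewrite diracE.
  have [h|/existsNP[i /not_implyP[iJ nB]]] :=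
    pselect (forall i, i \in J -> B i (0 - 0)).
    rewrite mem_set; last by move=> i /= iJ; exact: h.
    by rewrite big1// => i iJ; rewrite mem_set//; exact: h.
  rewrite memNset; last by move=> /(_ i iJ).
  by rewrite (bigD1 i)//= memNset ?mul0e.
- move=> t e r e0 r0; exists 1 => // s _; rewrite /= diracE memNset ?lee_fin ?ltW//.
  by rewrite /= subrr normr0 ltNge ltW.
Qed.

HB.instance Definition _ := gen_eqMixin levy_law.
HB.instance Definition _ := gen_choiceMixin levy_law.
HB.instance Definition _ :=
  isPointed.Build levy_law (SigSub (mem_set zero_levy_law)).

Definition law_of (g : levy_law) : probability (path_space R) R := val g.

Definition marginal (t : {nonneg R}) (g : levy_law) :
    pprobability R R :=
  distribution (law_of g) (coord t).

Definition marginal_sets : set (set levy_law) :=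
  \bigcup_t preimage_set_system setT (marginal t) measurable.

Definition levy_space : measurableType marginal_sets.-sigma :=
  g_sigma_algebraType marginal_sets.

Definition mixture (nu : probability levy_space R)
    d (T : measurableType d) (P : probability T R) (S : process P) :=
  forall A, measurable A ->
  P (trajectory S @^-1` A) = (\int[nu]_g law_of g A)%E.

Definition good (L : set levy_space) :=
  measurable L /\
  forall (nu1 nu2 : probability levy_space R)
    d1 (T1 : measurableType d1) (P1 : probability T1 R) (S1 : process P1)
    d2 (T2 : measurableType d2) (P2 : probability T2 R) (S2 : process P2),
  mixture nu1 S1 -> nu1 L = 1%E ->
  mixture nu2 S2 -> nu2 L = 1%E ->
  (forall t B, measurable B ->
     distribution P1 (S1 t) B = distribution P2 (S2 t) B) ->
  forall A, measurable A ->
    P1 (trajectory S1 @^-1` A) = P2 (trajectory S2 @^-1` A).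

Definition BM : set levy_space :=
  [set g | exists d (T : measurableType d) (P : probability T R)
     (Z : process P), brownian_motion Z /\ has_law Z (law_of g)].

End levy_laws.

Arguments BM R : clear implicits.

(* Main.v *)
(* For a Brownian law with drift b and rate v, E cos (u Z_t + a) equals
   exp (- u^2 t v / 2) cos (u t b + a). As (u, t) varies, the pair (u^2 t, u t)
   takes every value (w, s) with w > 0 and s != 0, so the one-time marginals of
   a mixture determine the integrals of exp (- w v / 2) cos (s b + a) against
   the mixing measure for all w >= 0 and all s, a. A product of such functions of
   (b, v) is a linear combination of functions of the same form; hence the
   expectation of a product of cosines of disjoint increments is determined, and
   the joint law of the increments with it. No law of (b, v) needs to be
   identified.

   Passing from cosines to indicators uses bounded pointwise limits only:
   trigonometric polynomials approximate the sign of sin ((x - y) / n), which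
   tends to the sign of x - y.

   For the measurability of BM, the rate and the drift of a Brownian law are read
   off its marginals (the drift as a limit at small times), and by continuity in
   frequency and time it suffices to test rational arguments. *)

From HB Require Import structures.
From mathcomp Require Import all_boot all_order all_algebra.
From mathcomp Require Import finmap complex ring lra.
From mathcomp Require Import all_classical all_reals all_analysis measurable_realfun.
Require Import Defs.

Set Implicit Arguments.
Unset Strict Implicit.
Unset Printing Implicit Defensive.

Import Order.TTheory GRing.Theory Num.Theory.
Import numFieldNormedType.Exports.

Local Open Scope classical_set_scope.
Local Open Scope ring_scope.

(** * Bounded classes of functions *)

Section bounded_measurable.
Context {R : realType} {d} {T : measurableType d}.
Implicit Types f g : T -> R.

Definition bounded_mfun f :=
  measurable_fun setT f /\ exists M, forall x, `|f x| <= M.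

Lemma bounded_mfun_cst c : bounded_mfun (fun=> c).
Proof. by split; [exact: measurable_cst|exists `|c|]. Qed.

Lemma bounded_mfun_linear a f g :
  bounded_mfun f -> bounded_mfun g -> bounded_mfun (fun x => a * f x + g x).
Proof.
move=> [mf [M fM]] [mg [N gN]]; split.
  by apply: measurable_funD => //; exact: measurable_funM.
exists (`|a| * M + N) => x; rewrite (le_trans (ler_normD _ _))// lerD//.
by rewrite normrM ler_wpM2l.
Qed.

Lemma bounded_mfunM f g :
  bounded_mfun f -> bounded_mfun g -> bounded_mfun (fun x => f x * g x).
Proof.
move=> [mf [M fM]] [mg [N gN]]; split; first exact: measurable_funM.
by exists (M * N) => x; rewrite normrM ler_pM.
Qed.

Lemma bounded_mfun_indic (A : set T) : measurable A -> bounded_mfun (\1_A).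
Proof.
move=> mA; split; first exact: measurable_indic.
by exists 1 => x; rewrite indicE; case: (_ \in _); rewrite ?normr1 ?normr0.
Qed.

Lemma bounded_mfun_prod n (F : 'I_n -> T -> R) :
  (forall i, bounded_mfun (F i)) -> bounded_mfun (fun x => \prod_(i < n) F i x).
Proof.
elim: n F => [|n IH] F HF.
  by under [X in bounded_mfun X]eq_fun do rewrite big_ord0; exact: bounded_mfun_cst.
under [X in bounded_mfun X]eq_fun do rewrite big_ord_recl.
by apply: bounded_mfunM => //; exact: IH.
Qed.

Lemma bounded_mfun_lim (f_ : (T -> R)^nat) f M :
  (forall n, measurable_fun setT (f_ n)) -> (forall n x, `|f_ n x| <= M) ->
  (forall x, f_ ^~ x @ \oo --> f x) -> bounded_mfun f.
Proof.
move=> mf fM ff; split; first exact: measurable_fun_cvg (fun x _ => ff x).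
exists M => x; have := cvg_norm (ff x); move=> /(_ _) h.
rewrite -(cvg_lim (@Rhausdorff R) h); apply: limr_le.
  by apply/cvg_ex; eexists; exact: h.
exact: nearW.
Qed.

Variable P : probability T R.

Lemma bounded_mfun_integrable f :
  bounded_mfun f -> P.-integrable setT (EFin \o f).
Proof.
move=> [mf [M fM]]; apply: measurable_bounded_integrable => //.
  by rewrite (le_lt_trans (probability_le1 P measurableT))// ltry.
exists M; split; first by rewrite num_real.
by move=> x Mx y _ /=; rewrite (le_trans (fM y))// ltW.
Qed.

Lemma Rintegral_linear a f g : bounded_mfun f -> bounded_mfun g ->
  \int[P]_x (a * f x + g x) = a * \int[P]_x f x + \int[P]_x g x.
Proof.
move=> bf bg; rewrite RintegralD//.
- by rewrite RintegralZl//; exact: bounded_mfun_integrable.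
- apply: bounded_mfun_integrable.
  by apply: bounded_mfunM => //; exact: bounded_mfun_cst.
- exact: bounded_mfun_integrable.
Qed.

Lemma Rintegral_bounded_cvg (f_ : (T -> R)^nat) f M :
  (forall n, measurable_fun setT (f_ n)) -> (forall n x, `|f_ n x| <= M) ->
  (forall x, f_ ^~ x @ \oo --> f x) ->
  \int[P]_x f_ n x @[n --> \oo] --> \int[P]_x f x.
Proof.
move=> mf fM ff.
have bf : bounded_mfun f by exact: bounded_mfun_lim ff.
have [|||||_ _ h] := @dominated_convergence _ T R P setT measurableT
  (fun n => EFin \o f_ n) (EFin \o f) (cst M%:E).
- by move=> n; apply/measurable_EFinP.
- by apply/measurable_EFinP; case: bf.
- by apply: aeW => x _ /=; apply: cvg_EFin; [exact: nearW|exact: ff].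
- apply: (@bounded_mfun_integrable (cst M)); exact: bounded_mfun_cst.
- by apply: aeW => x n _ /=; rewrite lee_fin.
apply: fine_cvg; rewrite /Rintegral fineK; first exact: h.
by apply: integrable_fin_num => //; exact: bounded_mfun_integrable.
Qed.

Lemma Rintegral_probability_cst c : \int[P]_x c = c.
Proof.
rewrite Rintegral_cst// [X in fine X](_ : _ = 1%E) ?mulr1//.
exact: probability_setT.
Qed.

Lemma Rintegral_indic (A : set T) : measurable A -> \int[P]_x \1_A x = fine (P A).
Proof. by move=> mA; rewrite /Rintegral integral_indic// setIT. Qed.

Lemma Rintegral_norm_le f M : measurable_fun setT f ->
  (forall x, `|f x| <= M) -> `|\int[P]_x f x| <= M.
Proof.
move=> mf fM; have bf : bounded_mfun f by split=> //; exists M.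
rewrite (le_trans (le_normr_Rintegral _ (bounded_mfun_integrable bf)))//.
rewrite -[leRHS]Rintegral_probability_cst.
apply: le_Rintegral => //; apply: bounded_mfun_integrable.
- by split; [exact: measurableT_comp|exists M => x; rewrite normr_id].
- exact: bounded_mfun_cst.
Qed.

End bounded_measurable.

(** * Functional monotone class argument *)

Section bounded_class.
Import HBNNSimple.
Context {R : realType} {d} {T : measurableType d}.
Implicit Types (C : set (T -> R)) (f g : T -> R).

(** These closure properties hold for the bounded measurable functions on which two integral
    functionals agree, the limit clause by dominated convergence. An identity checked on few test
    functions thus spreads to all bounded measurable ones. *)
Record bounded_class C : Prop := BoundedClass {
  bounded_class_linear : forall a f g, C f -> C g -> C (fun x => a * f x + g x) ;
  bounded_class_lim : forall (f_ : (T -> R)^nat) f M, (forall n, C (f_ n)) ->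
    (forall n x, `|f_ n x| <= M) -> (forall x, f_ ^~ x @ \oo --> f x) -> C f }.

Lemma bounded_class_zero C f : bounded_class C -> C f -> C (fun=> 0).
Proof.
move=> CC Cf; have := bounded_class_linear CC (-1) Cf Cf.
by congr (C _); apply/funext => x; rewrite mulN1r addNr.
Qed.

Lemma bounded_classZ C a f : bounded_class C -> C f -> C (fun x => a * f x).
Proof.
move=> CC Cf; have := bounded_class_linear CC a Cf (bounded_class_zero CC Cf).
by congr (C _); apply/funext => x; rewrite addr0.
Qed.

Lemma bounded_classD C f g : bounded_class C -> C f -> C g ->
  C (fun x => f x + g x).
Proof.
move=> CC Cf Cg; have := bounded_class_linear CC 1 Cf Cg.
by congr (C _); apply/funext => x; rewrite mul1r.
Qed.

Lemma bounded_class_sum C (I : Type) (s : seq I) (F : I -> T -> R) :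
  bounded_class C -> C (fun=> 0) -> (forall i, C (F i)) ->
  C (fun x => \sum_(i <- s) F i x).
Proof.
move=> CC C0 CF; elim: s => [|i s IH].
  by under [X in C X]eq_fun do rewrite big_nil.
under [X in C X]eq_fun do rewrite big_cons.
exact: bounded_classD.
Qed.

(** Adding the bound [M] makes [f] nonnegative, hence an increasing limit of simple functions, all
    bounded by [2 * M]; simple functions are linear combinations of indicators. *)
Lemma bounded_class_mfun C : bounded_class C ->
  (forall A, measurable A -> C (\1_A)) -> forall f, bounded_mfun f -> C f.
Proof.
move=> CC CI f [mf [M fM]].
have C1 : C (fun=> 1).
  by have := CI setT measurableT; congr (C _); apply/funext => x; rewrite indicT.
have C0 := bounded_class_zero CC C1.
pose h x := f x + M.
have h0 x : 0 <= h x.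
  by rewrite /h -lerBlDr sub0r; have := fM x; rewrite ler_norml => /andP[].
have mh : measurable_fun setT (EFin \o h).
  by apply/measurable_EFinP; apply: measurable_funD.
suff Ch : C h.
  have := bounded_class_linear CC (- M) C1 Ch.
  by congr (C _); apply/funext => x; rewrite /h; ring.
pose h_ n := nnsfun_approx measurableT mh n.
have h_h x : (h_ n x) @[n --> \oo] --> h x.
  have /fine_cvg := cvg_nnsfun_approx measurableT mh (fun x _ => h0 x) I (x := x).
  exact.
apply: (bounded_class_lim CC (f_ := fun n => h_ n) (M := 2 * M)) => //.
  move=> n.
  have -> : (h_ n : T -> R) =
      fun x => \sum_(y <- fset_set (range (h_ n))) y * \1_(h_ n @^-1` [set y]) x.
    by apply/funext => x; rewrite {1}fimfunE fsbig_finite.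
  apply: bounded_class_sum => // y; apply: bounded_classZ => //; apply: CI.
  by rewrite -[X in measurable X]setTI; exact: measurable_funP.
move=> n x; rewrite ger0_norm; last exact: fun_ge0.
have : h_ n x <= h x.
  rewrite -(cvg_lim (@Rhausdorff R) (h_h x)).
  apply: (nondecreasing_cvgn_le (u_ := fun n => h_ n x)).
    by move=> i j ij; apply/lefP/nd_nnsfun_approx.
  by apply/cvg_ex; exists (h x); exact: h_h.
by move=> /le_trans; apply; rewrite /h mulr_natl mulr2n lerD//
  (le_trans _ (fM x))// ler_norm.
Qed.

End bounded_class.

(** * From cosines to all bounded Borel functions *)

Section bounded_class_real.
Context {R : realType}.
Implicit Types (C : set (R -> R)) (u a x y : R).

(** The rays form a pi-system generating the Borel sets, and the sets whose indicator lies in [C]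
    form a Dynkin system. *)
Lemma bounded_class_indic C : bounded_class C -> C (fun=> 1) ->
  (forall y, C (\1_(`]y, +oo[%classic))) ->
  forall A : set R, measurable A -> C (\1_A).
Proof.
move=> CC C1 Cray A.
have mE : @measurable _ R = <<s @RGenOInfty.G R >>.
  exact: RGenOInfty.measurableE.
rewrite mE; apply: (dynkin_induction (P := fun A => C (\1_A)) mE).
- move=> _ _ [x ->] [y ->]; exists (Num.max x y).
  by apply/seteqP; split => z /=; rewrite !in_itv/= !andbT gt_max => /andP.
- by congr (C _): C1; apply/funext => x; rewrite indicT.
- by move=> _ [y ->].
- move=> B _ CB; have := bounded_class_linear CC (-1) CB C1.
  congr (C _); apply/funext => x; rewrite !indicE in_setC.
  by case: (x \in B); rewrite /= ?mulr1 ?mulr0 ?addNr ?add0r.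
- move=> F _ tF CF.
  (* By disjointness at most one term of the partial sum is nonzero, so the partial sums stay in {0,
     1} and are eventually constant. *)
  have FE x j : F j x -> forall n, \sum_(k < n) \1_(F k) x = (j < n)%:R :> R.
    move=> Fjx n; have F0 k : k != j -> \1_(F k) x = 0 :> R.
      move=> kj; rewrite indicE memNset// => Fkx; move/eqP : kj; apply.
      by apply: tF => //; exists x.
    have [jn|nj] := ltnP j n.
      rewrite (bigD1 (Ordinal jn))//= big1 ?addr0; first by rewrite indicE mem_set.
      by move=> i ij; apply: F0; apply: contra ij => /eqP ij; apply/eqP/val_inj.
    rewrite big1// => i _; apply: F0.
    by apply: contraTneq (ltn_ord i) => ->; rewrite -leqNgt.
  have F0E x : ~ (\bigcup_k F k) x -> forall n, \sum_(k < n) \1_(F k) x = 0 :> R.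
    move=> Fx n; rewrite big1// => i _; rewrite indicE memNset// => Fi.
    by apply: Fx; exists i.
  apply: (bounded_class_lim CC (f_ := fun n x => \sum_(k < n) \1_(F k) x) (M := 1)).
  + by move=> n; apply: bounded_class_sum => //; exact: bounded_class_zero C1.
  + move=> n x; have [[j _ /FE ->]|/F0E ->] := pselect ((\bigcup_k F k) x).
      by case: (_ < _)%N; rewrite ?normr1 ?normr0.
    by rewrite normr0.
  + move=> x; rewrite indicE.
    have [[j _ Fjx]|Fx] := pselect ((\bigcup_k F k) x).
      rewrite mem_set; last by exists j.
      apply: cvg_near_cst; exists j.+1 => // n /= jn.
      by rewrite (FE _ _ Fjx) jn.
    rewrite memNset//; apply: cvg_near_cst; apply: nearW => n.
    by rewrite F0E.
Qed.

(* Iterating y |-> (3 y - y^3) / 2, which fixes -1, 0 and 1, drives every other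
   point of [-1, 1] to its sign. *)
Fixpoint sign_poly n : {poly R} :=
  if n is m.+1 then (3 / 2)%:P * sign_poly m - (1 / 2)%:P * sign_poly m ^+ 3
  else 'X.

Lemma sign_polyS n y : (sign_poly n.+1).[y] =
  3 / 2 * (sign_poly n).[y] - 1 / 2 * (sign_poly n).[y] ^+ 3.
Proof. by rewrite /= !hornerE. Qed.

Lemma sign_polyN n y : (sign_poly n).[- y] = - (sign_poly n).[y].
Proof.
elim: n => [|n IH]; first by rewrite /= !hornerX.
by rewrite !sign_polyS IH; ring.
Qed.

Lemma sign_poly0 n : (sign_poly n).[0] = 0.
Proof.
elim: n => [|n IH]; first by rewrite /= hornerX.
by rewrite sign_polyS IH expr0n/= !mulr0 subrr.
Qed.

(** With [z] the current iterate, the next one exceeds it by z (1 - z^2) / 2 and falls short of 1 by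
    (1 - z)^2 (2 + z) / 2. The shortfall also equals (1 - (z + z^2) / 2) (1 - z), whose first factor
    is at most 1 - y / 2 because z >= y; hence the geometric rate. *)
Lemma sign_poly_bound n y : 0 < y <= 1 ->
  y <= (sign_poly n).[y] <= 1 /\ 1 - (sign_poly n).[y] <= (1 - y / 2) ^+ n.
Proof.
move=> /andP[y0 y1]; elim: n => [|n [/andP[]]].
  by rewrite /= hornerX lexx y1 expr0; split => //; lra.
rewrite sign_polyS [(1 - y / 2) ^+ n.+1]exprS; set z := (sign_poly n).[y] => yz z1 hz.
have zz1 : z ^+ 2 <= 1 by rewrite expr_le1//; lra.
have z0 : 0 <= z by lra.
split.
  have : 0 <= z * (1 - z ^+ 2) by rewrite mulr_ge0// subr_ge0.
  have : 0 <= (1 - z) ^+ 2 * (2 + z) by rewrite mulr_ge0 ?sqr_ge0//; lra.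
  by move=> *; apply/andP; split; nra.
have -> : 1 - (3 / 2 * z - 1 / 2 * z ^+ 3) = (1 - (z + z ^+ 2) / 2) * (1 - z).
  by field.
apply: ler_pM => //; nra.
Qed.

Lemma sign_poly_le1 n y : `|y| <= 1 -> `|(sign_poly n).[y]| <= 1.
Proof.
have pos z : 0 < z <= 1 -> `|(sign_poly n).[z]| <= 1.
  move=> /[dup] /andP[z0 _] /(sign_poly_bound n) [/andP[zp p1] _].
  by rewrite ger0_norm// (le_trans (ltW z0)).
have [y0|y0|->] := ltgtP y 0.
- rewrite ltr0_norm// => y1; rewrite -[y]opprK sign_polyN normrN pos//.
  by rewrite oppr_gt0 y0.
- by rewrite gtr0_norm// => y1; rewrite pos// y0.
- by rewrite sign_poly0 normr0.
Qed.

Lemma sign_poly_cvg y : `|y| <= 1 -> (sign_poly n).[y] @[n --> \oo] --> Num.sg y.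
Proof.
have pos z : 0 < z -> `|z| <= 1 -> (sign_poly n).[z] @[n --> \oo] --> (1 : R).
  move=> z0; rewrite gtr0_norm// => z1.
  have hz n := @sign_poly_bound n z (introT andP (conj z0 z1)).
  apply: (@squeeze_cvgr _ _ _ _ (fun n => 1 - (1 - z / 2) ^+ n) (cst 1)).
  - by apply: nearW => n; have [/andP[_ ->]] := hz n; rewrite andbT; lra.
  - rewrite -[X in _ --> X]subr0; apply: cvgB; first exact: cvg_cst.
    by apply: cvg_expr; rewrite ger0_norm; lra.
  - exact: cvg_cst.
have [y0|y0|->] := ltgtP y 0 => y1.
- have -> : (fun n => (sign_poly n).[y]) = (fun n => - (sign_poly n).[- y]).
    by apply/funext => n; rewrite sign_polyN opprK.
  rewrite ltr0_sg//.
  by apply: cvgN; apply: pos; rewrite ?normrN// oppr_gt0.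
- by rewrite gtr0_sg//; exact: pos.
- by rewrite sgr0; under eq_fun do rewrite sign_poly0; exact: cvg_cst.
Qed.

Section trigonometric.
Variable C : set (R -> R).
Hypothesis CC : bounded_class C.
Hypothesis Ccos : forall u a, C (fun x => cos (u * x + a)).

(** Each factor sin B is absorbed by cos A sin B = (sin (A + B) - sin (A - B)) / 2; the sines are
    again cosines, with phase shifted by pi / 2, so the induction keeps frequency and phase free. *)
Lemma bounded_class_cos_sinX n u a v b :
  C (fun x => cos (u * x + a) * sin (v * x + b) ^+ n).
Proof.
elim: n u a => [|n IH] u a.
  by under [X in C X]eq_fun do rewrite expr0 mulr1.
have := bounded_class_linear CC (-1) (IH (u - v) (a - b - pi / 2))
  (IH (u + v) (a + b - pi / 2)).
move=> /(bounded_classZ (2^-1) CC); congr (C _); apply/funext => x.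
rewrite exprS.
have -> : (u - v) * x + (a - b - pi / 2) = (u * x + a - (v * x + b)) - pi / 2.
  by ring.
have -> : (u + v) * x + (a + b - pi / 2) = (u * x + a + (v * x + b)) - pi / 2.
  by ring.
move: (u * x + a) (v * x + b) => A B.
by rewrite !cosBpihalf sinB sinD; move: (sin B ^+ n) => S; field.
Qed.

Lemma bounded_class_horner_sin (p : {poly R}) v b :
  C (fun x => p.[sin (v * x + b)]).
Proof.
under [X in C X]eq_fun do rewrite horner_coef.
have Csin n : C (fun x => sin (v * x + b) ^+ n).
  have := bounded_class_cos_sinX n 0 0 v b; congr (C _); apply/funext => x.
  by rewrite mul0r addr0 cos0 mul1r.
apply: bounded_class_sum => //; first exact: bounded_class_zero (Csin 0).
by move=> i; exact: bounded_classZ.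
Qed.

Lemma bounded_class_sg_sin v b : C (fun x => Num.sg (sin (v * x + b))).
Proof.
have sin1 x : `|sin (v * x + b)| <= 1 by rewrite sin_max.
apply: (bounded_class_lim CC (M := 1)
  (f_ := fun n x => (sign_poly n).[sin (v * x + b)])).
- by move=> n; exact: bounded_class_horner_sin.
- by move=> n x; exact: sign_poly_le1.
- by move=> x; exact: sign_poly_cvg.
Qed.

(** Once n + 1 exceeds |x - y|, the argument (x - y) / (n + 1) lies in (-1, 1), where the sine has
    the sign of its argument; the sequence is then constant. *)
Lemma bounded_class_sg y : C (fun x => Num.sg (x - y)).
Proof.
apply: (bounded_class_lim CC (M := 1)
  (f_ := fun n x => Num.sg (sin (n.+1%:R^-1 * x + (- (n.+1%:R^-1 * y)))))).
- by move=> n; exact: bounded_class_sg_sin.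
- by move=> n x; rewrite normr_sg; case: (_ == 0); rewrite //= ?lexx.
- move=> x; apply: cvg_near_cst; near=> n.
  rewrite -mulrBr.
  have n0 : (0 : R) < n.+1%:R^-1 by rewrite invr_gt0.
  have pos (z : R) : 0 < z -> z < n.+1%:R -> 0 < sin (n.+1%:R^-1 * z).
    move=> z0 zn; apply: sin_gt0_pi; rewrite mulr_gt0//=.
    rewrite (@lt_le_trans _ _ 1)//; first by rewrite mulrC ltr_pdivrMr// mul1r.
    by rewrite (le_trans _ (pi_ge2 R))// ler1n.
  have xyn : `|x - y| < n.+1%:R.
    by rewrite (@lt_trans _ _ n%:R) ?ltr_nat//; near: n; exact: nbhs_infty_gtr.
  have [xy|xy|xy] := ltgtP (x - y) 0.
  + rewrite (ltr0_sg xy) -[x - y]opprK mulrN sinN ltr0_sg// oppr_lt0 pos//.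
      by rewrite oppr_gt0.
    by rewrite -ltr0_norm.
  + by rewrite (gtr0_sg xy) gtr0_sg// pos// -(gtr0_norm xy).
  + by rewrite xy mulr0 sin0.
Unshelve. all: by end_near. Qed.

Lemma bounded_class_cos : forall f, bounded_mfun f -> C f.
Proof.
have C1 : C (fun=> 1).
  by have := Ccos 0 0; congr (C _); apply/funext => x; rewrite mul0r addr0 cos0.
apply: bounded_class_mfun => //; apply: bounded_class_indic => // y.
(* The threshold approaches [y] from the right, so that at x = y the sign is -1 and the limit there
   is 0, as for the open ray; without the shift it would be 1 / 2. *)
apply: (bounded_class_lim CC (M := 1)
  (f_ := fun n x => 2^-1 * Num.sg (x - (y + n.+1%:R^-1)) + 2^-1)).
- move=> n; apply: bounded_class_linear => //; first exact: bounded_class_sg.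
  have := bounded_classZ 2^-1 CC C1; congr (C _).
  by apply/funext => x; rewrite mulr1.
- by move=> n x; rewrite ler_norml; case: sgrP => _; lra.
- move=> x; apply: cvg_near_cst.
  have [xy|xy] := leP x y.
    apply: nearW => n; rewrite indicE memNset ?ltr0_sg; first by rewrite mulrN1 addNr.
      by rewrite subr_lt0 (le_lt_trans xy)// ltrDl invr_gt0.
    by rewrite /= in_itv/= andbT; apply/negP; rewrite -leNgt.
  near=> n; rewrite indicE mem_set ?gtr0_sg; first by rewrite mulr1 -div1r -splitr.
    rewrite subr_gt0 -ltrBrDl; near: n.
    by apply: near_infty_natSinv_lt (PosNum _); rewrite subr_gt0.
  by rewrite /= in_itv/= andbT.
Unshelve. all: by end_near. Qed.

End trigonometric.
End bounded_class_real.

(** * Integrals against the marginals of a law *)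

Section marginal_integral.
Context {R : realType}.
Implicit Types (t : {nonneg R}) (f : R -> R) (g : levy_space R).

Definition marginal_int t f g : R :=
  \int[(marginal t g : probability R R)]_x f x.

Lemma measurable_marginal t :
  measurable_fun setT (marginal t : levy_space R -> pprobability R R).
Proof.
move=> _ B mB; apply: sub_sigma_algebra; exists t => //.
by exists B.
Qed.

Lemma marginal_int_indic t (B : set R) g : measurable B ->
  (marginal_int t (\1_B) g)%:E = marginal t g B.
Proof.
move=> mB; rewrite /marginal_int Rintegral_indic// fineK//.
exact: fin_num_measure.
Qed.

Lemma norm_marginal_int_le t f M g : measurable_fun setT f ->
  (forall x, `|f x| <= M) -> `|marginal_int t f g| <= M.
Proof. exact: Rintegral_norm_le. Qed.

Lemma marginal_int_linear t a f h g : bounded_mfun f -> bounded_mfun h ->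
  marginal_int t (fun x => a * f x + h x) g =
  a * marginal_int t f g + marginal_int t h g.
Proof. exact: Rintegral_linear. Qed.

Lemma marginal_int_cvg t (f_ : (R -> R)^nat) f M g :
  (forall n, measurable_fun setT (f_ n)) -> (forall n x, `|f_ n x| <= M) ->
  (forall x, f_ ^~ x @ \oo --> f x) ->
  marginal_int t (f_ n) g @[n --> \oo] --> marginal_int t f g.
Proof. exact: Rintegral_bounded_cvg. Qed.

(** Monotone class argument: for indicators this is the measurability of [marginal t], viewed as a
    probability kernel, and measurability survives linear combinations and pointwise limits. *)
Lemma bounded_mfun_marginal_int t f :
  bounded_mfun f -> bounded_mfun (marginal_int t f).
Proof.
move=> bf; suff mf : measurable_fun setT (marginal_int t f).
  by split => //; case: bf => mf' [M fM]; exists M => g; exact: norm_marginal_int_le.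
pose C := [set f : R -> R | bounded_mfun f /\ measurable_fun setT (marginal_int t f)].
suff [] : C f by [].
apply: bounded_class_mfun bf => [|B mB].
- split=> [a f1 f2 [bf1 mf1] [bf2 mf2]|f_ f1 M Cf fM ff].
    split; first exact: bounded_mfun_linear.
    have -> : marginal_int t (fun x => a * f1 x + f2 x) =
        (fun g => a * marginal_int t f1 g + marginal_int t f2 g).
      by apply/funext => g; exact: marginal_int_linear.
    by apply: measurable_funD => //; exact: measurable_funM.
  have mf_ n : measurable_fun setT (f_ n) by case: (Cf n) => -[].
  split; first exact: bounded_mfun_lim ff.
  apply: (measurable_fun_cvg (h := fun n => marginal_int t (f_ n))).
    by move=> n; case: (Cf n).
  by move=> g _; exact: marginal_int_cvg ff.
- split; first exact: bounded_mfun_indic.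
  have /measurable_EFinP : measurable_fun setT (EFin \o marginal_int t (\1_B)).
    rewrite (_ : _ \o _ = fun g => marginal t g B).
      exact: (measurable_kernel (kprobability (measurable_marginal t)) B mB).
    by apply/funext => g /=; exact: marginal_int_indic.
  by [].
Qed.

Lemma marginal_int_law d (T : measurableType d) (P : probability T R)
    (Z : process P) t f g : has_law Z (law_of g) -> bounded_mfun f ->
  marginal_int t f g = \int[P]_w f (Z t w).
Proof.
move=> Zg bf; rewrite /marginal_int /Rintegral; congr fine.
have -> : (\int[P]_x (f (Z t x))%:E = \int[pushforward P (Z t)]_x (f x)%:E)%E.
  rewrite integral_pushforward// ?preimage_setT//.
  - by apply/measurable_EFinP; case: bf.
  - apply: bounded_mfun_integrable; case: bf => mf [M fM]; split.
      exact: measurableT_comp.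
    by exists M => w.
apply: eq_measure_integral => B mB _.
apply: (Zg (coord t @^-1` B)).
by rewrite -[X in measurable X]setTI; exact: measurable_coord.
Qed.

Variables nu1 nu2 : probability (levy_space R) R.

(** The weights stand for the other factors of a product of marginal integrals while a single factor
    is varied. *)
Lemma bounded_class_weighted t (W1 W2 : levy_space R -> R) :
  bounded_mfun W1 -> bounded_mfun W2 ->
  bounded_class [set f | bounded_mfun f /\
    \int[nu1]_g (W1 g * marginal_int t f g) =
    \int[nu2]_g (W2 g * marginal_int t f g)].
Proof.
move=> bW1 bW2; split=> [a f1 f2 [bf1 mf1] [bf2 mf2]|f_ f1 M Cf fM ff].
  split; first exact: bounded_mfun_linear.
  have E (nu : probability (levy_space R) R) W : bounded_mfun W ->
      \int[nu]_g (W g * marginal_int t (fun x => a * f1 x + f2 x) g) =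
      a * \int[nu]_g (W g * marginal_int t f1 g) +
      \int[nu]_g (W g * marginal_int t f2 g).
    move=> bW; rewrite -Rintegral_linear//; last 2 first.
    - by apply: bounded_mfunM => //; exact: bounded_mfun_marginal_int.
    - by apply: bounded_mfunM => //; exact: bounded_mfun_marginal_int.
    apply: eq_Rintegral => g _; rewrite marginal_int_linear//; ring.
  by rewrite !E// mf1 mf2.
have bf n : bounded_mfun (f_ n) by case: (Cf n).
have mf n : measurable_fun setT (f_ n) by case: (bf n).
split; first exact: bounded_mfun_lim ff.
have E (nu : probability (levy_space R) R) W : bounded_mfun W ->
    \int[nu]_g (W g * marginal_int t (f_ n) g) @[n --> \oo] -->
    \int[nu]_g (W g * marginal_int t f1 g).
  move=> [mW [N WN]]; apply: (Rintegral_bounded_cvg (M := N * M)).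
  - move=> n; apply: measurable_funM => //.
    by have [] := bounded_mfun_marginal_int t (bf n).
  - by move=> n g; rewrite normrM ler_pM// norm_marginal_int_le.
  - by move=> g; apply: cvgMl_tmp; exact: marginal_int_cvg ff.
have E12 : (fun n => \int[nu1]_g (W1 g * marginal_int t (f_ n) g)) =
    (fun n => \int[nu2]_g (W2 g * marginal_int t (f_ n) g)).
  by apply/funext => n; case: (Cf n).
have := E nu1 W1 bW1; rewrite E12 => /cvg_unique; apply; first exact: Rhausdorff.
exact: E.
Qed.

Lemma bounded_mfun_cos u a : bounded_mfun (fun x : R => cos (u * x + a)).
Proof.
split; last by exists 1 => x; exact: cos_max.
apply: measurableT_comp; last first.
  by apply: measurable_funD => //; exact: measurable_funM.
by apply: continuous_measurable_fun; exact: continuous_cos.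
Qed.

(** Cosines are replaced by arbitrary functions one factor at a time, the remaining factors being
    stored in the weights. *)
Lemma eq_weighted_marginal_prod n (t : 'I_n -> {nonneg R})
    (W1 W2 : levy_space R -> R) : bounded_mfun W1 -> bounded_mfun W2 ->
  (forall u a : 'I_n -> R,
    \int[nu1]_g (W1 g * \prod_i marginal_int (t i) (fun x => cos (u i * x + a i)) g) =
    \int[nu2]_g (W2 g * \prod_i marginal_int (t i) (fun x => cos (u i * x + a i)) g)) ->
  forall f : 'I_n -> R -> R, (forall i, bounded_mfun (f i)) ->
    \int[nu1]_g (W1 g * \prod_i marginal_int (t i) (f i) g) =
    \int[nu2]_g (W2 g * \prod_i marginal_int (t i) (f i) g).
Proof.
elim: n t W1 W2 => [|n IH] t W1 W2 bW1 bW2 Wcos f bf.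
  have E0 (nu : probability (levy_space R) R) W (h : 'I_0 -> R -> R) :
      \int[nu]_g (W g * \prod_i marginal_int (t i) (h i) g) = \int[nu]_g W g.
    by apply: eq_Rintegral => g _; rewrite big_ord0 mulr1.
  by have := Wcos (fun=> 0) (fun=> 0); rewrite !E0.
pose Q g := \prod_(i < n) marginal_int (t (lift ord0 i)) (f (lift ord0 i)) g.
have bQ : bounded_mfun Q.
  by apply: bounded_mfun_prod => i; exact: bounded_mfun_marginal_int.
have E (nu : probability (levy_space R) R) W (h : 'I_n.+1 -> R -> R) :
    \int[nu]_g (W g * \prod_i marginal_int (t i) (h i) g) =
    \int[nu]_g (W g * marginal_int (t ord0) (h ord0) g *
      \prod_(i < n) marginal_int (t (lift ord0 i)) (h (lift ord0 i)) g).
  by apply: eq_Rintegral => g _; rewrite big_ord_recl mulrA.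
have E' (nu : probability (levy_space R) R) W h :
    \int[nu]_g (W g * marginal_int (t ord0) h g * Q g) =
    \int[nu]_g (W g * Q g * marginal_int (t ord0) h g).
  by apply: eq_Rintegral => g _; rewrite mulrAC.
rewrite !E -/(Q _) !E'.
(* The tail [Q] already carries the general functions and joins the weights, so the monotone class
   argument applies to the head alone. *)
have bWQ1 := bounded_mfunM bW1 bQ; have bWQ2 := bounded_mfunM bW2 bQ.
suff: forall f0, bounded_mfun f0 -> bounded_mfun f0 /\
    \int[nu1]_g (W1 g * Q g * marginal_int (t ord0) f0 g) =
    \int[nu2]_g (W2 g * Q g * marginal_int (t ord0) f0 g).
  by move=> /(_ _ (bf ord0))[].
apply: bounded_class_cos => [|u a]; first exact: bounded_class_weighted.
split; first exact: bounded_mfun_cos.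
(* When the head is a cosine, it is the head that joins the weights, and the induction hypothesis
   generalizes the tail. *)
rewrite -!E'; apply: (IH (fun i => t (lift ord0 i))).
- apply: bounded_mfunM => //; apply: bounded_mfun_marginal_int.
  exact: bounded_mfun_cos.
- apply: bounded_mfunM => //; apply: bounded_mfun_marginal_int.
  exact: bounded_mfun_cos.
- move=> u' a'.
  (* [v] and [b] prepend the frequency and phase of the head to those of the tail. *)
  pose v i := if unlift ord0 i is Some j then u' j else u.
  pose b i := if unlift ord0 i is Some j then a' j else a.
  have := Wcos v b; rewrite !E /v /b unlift_none.
  move=> {}E; apply: etrans (etrans E _).
  + by apply: eq_Rintegral => g _; congr (_ * _); apply: eq_bigr => i _; rewrite liftK.
  + by apply: eq_Rintegral => g _; congr (_ * _); apply: eq_bigr => i _; rewrite liftK.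
- by move=> i; exact: bf.
Qed.

Lemma eq_Rintegral_marginal_int t :
  (forall B, measurable B ->
    \int[nu1]_g marginal_int t (\1_B) g = \int[nu2]_g marginal_int t (\1_B) g) ->
  forall f, bounded_mfun f ->
    \int[nu1]_g marginal_int t f g = \int[nu2]_g marginal_int t f g.
Proof.
have b1 : bounded_mfun (fun _ : levy_space R => 1 : R) by exact: bounded_mfun_cst.
have E (nu : probability (levy_space R) R) f :
    \int[nu]_g marginal_int t f g = \int[nu]_g (1 * marginal_int t f g).
  by apply: eq_Rintegral => g _; rewrite mul1r.
move=> eqB f bf; have := bounded_class_mfun (bounded_class_weighted t b1 b1) _ bf.
rewrite !E; case=> // B mB.
by split; [exact: bounded_mfun_indic|rewrite -!E; exact: eqB].
Qed.

End marginal_integral.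

(** * Brownian laws form a measurable set *)

Section brownian_laws.
Local Open Scope complex_scope.
Context {R : realType}.
Implicit Types (t : {nonneg R}) (g : levy_space R) (b v u a x y : R).

Lemma cexp_polar x y :
  cexp ('i * x%:C - y%:C) = (expR (- y) * cos x) +i* (expR (- y) * sin x).
Proof.
by rewrite /cexp /=; simpc.
Qed.

Lemma cexp_imaginary x : cexp ('i * x%:C) = cos x +i* sin x.
Proof.
by rewrite /cexp /=; simpc; rewrite expR0 !mul1r.
Qed.

Lemma dist_cos_le x y : `|cos x - cos y| <= `|x - y|.
Proof.
wlog yx : x y / y <= x.
  by move=> H; have [/H//|/ltW/H] := leP y x; rewrite distrC (distrC x).
have [|c _ ->] := @MVT_segment R cos (fun x => - sin x) y x yx.
  by apply: continuous_subspaceT; exact: continuous_cos.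
by rewrite normrM normrN ler_piMl// sin_max.
Qed.

(** Real encoding of the characteristic function: phase 0 gives its real part and phase [- (pi / 2)]
    its imaginary part. *)
Definition cos_marginal u a t g := marginal_int t (fun x => cos (u * x + a)) g.

Definition gaussian_cos b v u a t : R :=
  expR (- (u ^+ 2 * t%:num * v / 2)) * cos (u * t%:num * b + a).

Definition gaussian_marginals b v g := 0 <= v /\
  forall u a t, cos_marginal u a t g = gaussian_cos b v u a t.

(** The addition formula for cosine reduces every phase to the two that encode the real and
    imaginary parts. *)
Lemma cos_marginalE u a t g : cos_marginal u a t g =
  cos a * cos_marginal u 0 t g - sin a * cos_marginal u (- (pi / 2)) t g.
Proof.
have bcos c : bounded_mfun (fun x => cos (u * x + c)) by exact: bounded_mfun_cos.
have E : (fun x => cos (u * x + a)) = (fun x =>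
    - sin a * cos (u * x + - (pi / 2)) + (cos a * cos (u * x + 0) + 0)).
  by apply/funext => x; rewrite cosBpihalf !addr0 cosD; ring.
have b0 : bounded_mfun (fun _ : R => 0 : R) by exact: bounded_mfun_cst.
rewrite /cos_marginal E marginal_int_linear//; last exact: bounded_mfun_linear.
rewrite marginal_int_linear// [marginal_int t (fun=> 0) g]Rintegral_probability_cst.
by rewrite addr0 mulNr addrC.
Qed.

Lemma BM_gaussianP g : BM R g <-> exists b v, gaussian_marginals b v g.
Proof.
split.
- move=> [d [T [P [Z [[_ [b [v [v0 Zchar]]]] Zg]]]]]; exists b, v; split => //.
  have char u t : cos_marginal u 0 t g =
        expR (- (u ^+ 2 * t%:num * v / 2)) * cos (u * t%:num * b) /\
      cos_marginal u (- (pi / 2)) t g =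
        expR (- (u ^+ 2 * t%:num * v / 2)) * sin (u * t%:num * b).
    have := Zchar u t; rewrite cexp_polar.
    rewrite (_ : (fun w => _) = fun w => cos (u * Z t w) +i* sin (u * Z t w)).
      move=> [<- <-]; rewrite /cos_marginal !(marginal_int_law _ Zg);
        try exact: bounded_mfun_cos.
      by split; apply: eq_Rintegral => w _; rewrite /= ?addr0 ?cosBpihalf.
    by apply/funext => w; exact: cexp_imaginary.
  move=> u a t; rewrite /gaussian_cos cos_marginalE.
  by rewrite !(char _ _).1 !(char _ _).2 cosD; ring.
- move=> [b [v [v0 gbv]]].
  (* A point of [levy_space] comes with a Lévy process realizing it, so only the characteristic
     function remains to be checked. *)
  have [d [T [P [Z [Zlevy Zg]]]]] := set_mem (valP g).
  exists d, T, P, Z; split => //; split => //; exists b, v; split => // u t.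
  rewrite cexp_polar /cexpectation; congr (_ +i* _).
  + have := gbv u 0 t; rewrite /gaussian_cos addr0 => <-.
    rewrite /cos_marginal (marginal_int_law _ Zg); last exact: bounded_mfun_cos.
    by apply: eq_Rintegral => w _; rewrite cexp_imaginary/= addr0.
  + have := gbv u (- (pi / 2)) t; rewrite /gaussian_cos cosBpihalf => <-.
    rewrite /cos_marginal (marginal_int_law _ Zg); last exact: bounded_mfun_cos.
    by apply: eq_Rintegral => w _; rewrite cexp_imaginary/= cosBpihalf.
Qed.

(* Truncated at 0 so that exponentials of [- w * rate g] are bounded also at
   the laws that are not Brownian. *)
Definition rate g : R := Num.max 0
  (- ln (cos_marginal 1 0 1%:nng g ^+ 2 +
         cos_marginal 1 (- (pi / 2)) 1%:nng g ^+ 2)).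

(** For a Brownian law the sequence is (n + 1) E sin Z at time 1 / (n + 1), a difference quotient at
    time 0. The upper limit exists for every law and is measurable. *)
Definition drift g : R := fine (limn_esup (fun n =>
  (n.+1%:R * cos_marginal 1 (- (pi / 2)) (n.+1%:R^-1)%:nng g)%:E)).

Lemma measurable_cos_marginal u a t : measurable_fun setT (cos_marginal u a t).
Proof. by have [] := bounded_mfun_marginal_int t (bounded_mfun_cos u a). Qed.

Lemma measurable_rate : measurable_fun setT rate.
Proof.
apply: measurable_maxr => //; apply: measurable_funN.
apply: measurableT_comp; first exact: measurable_ln.
by apply: measurable_funD; apply: measurable_funX; exact: measurable_cos_marginal.
Qed.

Lemma measurable_drift : measurable_fun setT drift.
Proof.
apply: measurableT_comp; first exact: fine_measurable.
apply: measurable_fun_limn_esup => n; apply/measurable_EFinP.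
by apply: measurable_funM => //; exact: measurable_cos_marginal.
Qed.

Lemma rate_ge0 g : 0 <= rate g.
Proof. by rewrite /rate le_max lexx. Qed.

(** The squared modulus of the characteristic function at frequency 1 and time 1 is exp (- v): the
    drift only rotates. *)
Lemma gaussian_rate b v g : gaussian_marginals b v g -> rate g = v.
Proof.
move=> [v0 gbv]; rewrite /rate !gbv /gaussian_cos /=.
rewrite cosBpihalf !exprMn -mulrDr addr0 cos2Dsin2.
rewrite mulr1 -expRM_natl expRK (_ : - _ = v); first exact/max_idPr.
by field.
Qed.

Lemma cvg_sin_div b : n.+1%:R * sin (n.+1%:R^-1 * b) @[n --> \oo] --> b.
Proof.
(* For b != 0 this is the derivative of sine at 0 along b / (n + 1), a sequence that must avoid
   0. *)
have [->|b0] := eqVneq b 0.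
  by under eq_fun do rewrite mulr0 sin0 mulr0; exact: cvg_cst.
have [] := is_derive_sin (0 : R); rewrite /derivable /derive => dsin lsin.
have cn : n.+1%:R^-1 * b @[n --> \oo] --> (0 : R).
  by rewrite -[X in _ --> X](mul0r b); apply: cvgMr_tmp; exact: cvg_harmonic.
have n0 n : n.+1%:R^-1 * b != 0 by rewrite mulf_neq0// invr_eq0.
move: dsin; rewrite lsin cos0 => /cvgr_dnbhsP /(_ _ (conj n0 cn)) h.
rewrite -[X in _ --> X]mulr1.
rewrite [X in X @ _](_ : _ = fun n => b * ((n.+1%:R^-1 * b)^-1 *:
  ((sin \o shift 0) ((n.+1%:R^-1 * b) *: 1) - sin 0))); first exact: cvgMl_tmp.
apply/funext => n.
rewrite /= /shift /= sin0 addr0 subr0 [_ *: 1]mulr1 /GRing.scale/= invfM invrK.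
by move: (sin _) => s; field.
Qed.

Lemma gaussian_drift b v g : gaussian_marginals b v g -> drift g = b.
Proof.
move=> [v0 gbv]; rewrite /drift.
set s := (fun n => _).
suff sb : s @ \oo --> b%:E.
  by rewrite is_cvg_limn_esupE; [rewrite (cvg_lim _ sb)|apply/cvg_ex; exists b%:E].
apply: cvg_EFin; first exact: nearW.
rewrite (_ : fine \o s = fun n => expR (- (n.+1%:R^-1 * v / 2)) *
    (n.+1%:R * sin (n.+1%:R^-1 * b))); last first.
  apply/funext => n; rewrite /s /= gbv /gaussian_cos/= cosBpihalf expr1n !mul1r; ring.
rewrite -[X in _ --> X]mul1r; apply: cvgM; last exact: cvg_sin_div.
rewrite -[X in _ --> X]expR0; apply: continuous_cvg; first exact: continuous_expR.
rewrite -[X in _ --> X]oppr0; apply: cvgN.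
rewrite -[X in _ --> X](mul0r (2^-1)); apply: cvgMr_tmp.
rewrite -[X in _ --> X](mul0r v); apply: cvgMr_tmp.
exact: cvg_harmonic.
Qed.

Lemma cos_marginal_cvg_freq (u_ : R^nat) u a t g : u_ @ \oo --> u ->
  cos_marginal (u_ n) a t g @[n --> \oo] --> cos_marginal u a t g.
Proof.
move=> uu; apply: (marginal_int_cvg (M := 1)).
- by move=> n; have [] := bounded_mfun_cos (u_ n) a.
- by move=> n x; exact: cos_max.
- move=> x; apply: continuous_cvg; first exact: continuous_cos.
  by apply: cvgD; [exact: cvgMr_tmp|exact: cvg_cst].
Qed.

(** Continuity in probability of a process with law [g] suffices, because the cosine is bounded and
    Lipschitz. *)
Lemma cos_marginal_cvg_time (t_ : nat -> {nonneg R}) u a t g :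
  (t_ n)%:num @[n --> \oo] --> t%:num ->
  cos_marginal u a (t_ n) g @[n --> \oo] --> cos_marginal u a t g.
Proof.
move=> tt; have [d [T [P [Z [[_ _ _ Zcont] Zg]]]]] := set_mem (valP g).
have E s : cos_marginal u a s g = \int[P]_w cos (u * Z s w + a).
  by apply: marginal_int_law => //; exact: bounded_mfun_cos.
have bZ s : bounded_mfun (fun w => cos (u * Z s w + a)).
  have [mc [M cM]] := bounded_mfun_cos u a; split; last by exists M => w.
  exact: (measurableT_comp mc).
apply/cvgrPdist_le => e e0.
(* Off the event [N] below the cosines differ by at most |u| c <= e / 2; on [N] they differ by at
   most 2, and [N] has probability at most e / 4. The [+ 1] covers u = 0. *)
pose c := e / 2 / (`|u| + 1).
have u1 : 0 < `|u| + 1 by rewrite ltr_wpDl.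
have c0 : 0 < c by rewrite /c !divr_gt0.
have [|delta delta0 Zdelta] := Zcont t c (e / 4) c0; first by rewrite divr_gt0.
move/cvgrPdist_lt : tt => /(_ _ delta0); apply: filterS => n tn.
rewrite !E; set s := t_ n.
pose N := [set w | c < `|Z s w - Z t w|].
have mN : measurable N.
  have mD : measurable_fun setT (fun w => `|Z s w - Z t w|).
    by apply: measurableT_comp => //; exact: measurable_funB.
  rewrite -[N]setTI (_ : N = (fun w => `|Z s w - Z t w|) @^-1` `]c, +oo[%classic).
    exact: mD.
  by apply/seteqP; split => w /=; rewrite in_itv/= andbT.
have PN : fine (P N) <= e / 4.
  rewrite -lee_fin fineK; last exact: fin_num_measure.
  by apply: Zdelta; rewrite distrC.
have bD : bounded_mfun (fun w => -1 * cos (u * Z s w + a) + cos (u * Z t w + a)).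
  exact: bounded_mfun_linear.
have bN : bounded_mfun (fun w => 2 * \1_N w + e / 2).
  apply: bounded_mfun_linear; [exact: bounded_mfun_indic|exact: bounded_mfun_cst].
rewrite addrC -mulN1r -Rintegral_linear//.
apply: le_trans (le_normr_Rintegral _ (bounded_mfun_integrable P bD)) _ => //.
apply: (@le_trans _ _ (\int[P]_w (2 * \1_N w + e / 2))).
  apply: le_Rintegral => //; last move=> w _.
  - apply: bounded_mfun_integrable; case: bD => mD [M DM]; split.
      exact: measurableT_comp.
    by exists M => w; rewrite normr_id.
  - exact: bounded_mfun_integrable.
  - rewrite mulN1r addrC indicE; have [Nw|Nw] := boolP (w \in N).
      rewrite mulr1 (le_trans (ler_normB _ _))//.
      have := cos_max (u * Z t w + a); have := cos_max (u * Z s w + a).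
      by move=> *; lra.
    rewrite mulr0 add0r (le_trans (dist_cos_le _ _))//.
    rewrite opprD addrACA subrr addr0 -mulrBr normrM.
    rewrite (@le_trans _ _ (`|u| * c))//.
      rewrite ler_wpM2l// distrC leNgt; apply/negP => Nw'.
      by move/negP : Nw; apply; rewrite inE.
    by rewrite /c mulrCA ler_piMr ?divr_ge0 ?(ltW e0)// ler_pdivrMr// mul1r lerDl.
rewrite Rintegral_linear; last 2 first.
- exact: bounded_mfun_indic.
- exact: bounded_mfun_cst.
rewrite Rintegral_probability_cst Rintegral_indic//; lra.
Qed.

Lemma cvg_trunc_div x : 0 <= x ->
  (Num.trunc (x * n.+1%:R))%:R / n.+1%:R @[n --> \oo] --> x.
Proof.
move=> x0.
apply: (@squeeze_cvgr _ _ _ _ (fun n => x - n.+1%:R^-1) (cst x)).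
- apply: nearW => n; have /truncn_itv/andP[lo hi] : 0 <= x * n.+1%:R by rewrite mulr_ge0.
  rewrite ler_pdivlMr// ler_pdivrMr// lo andbT mulrBl mulVf// lerBlDr.
  by rewrite ltW// natr1.
- rewrite -[X in _ --> X]subr0; apply: cvgB; first exact: cvg_cst.
  exact: cvg_harmonic.
- exact: cvg_cst.
Qed.

Lemma measurable_set_eq d (T : measurableType d) (f h : T -> R) :
  measurable_fun setT f -> measurable_fun setT h -> measurable [set w | f w = h w].
Proof.
move=> mf mh.
rewrite (_ : [set w | _] = (fun w => f w == h w) @^-1` [set true]).
  by rewrite -[X in measurable X]setTI; exact: measurable_fun_eqr.
by apply/seteqP; split => w /= /eqP.
Qed.

Lemma cos_marginalN u a t g : cos_marginal (- u) (- a) t g = cos_marginal u a t g.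
Proof.
rewrite /cos_marginal; congr (marginal_int t _ g); apply/funext => x.
by rewrite mulNr -opprD cosN.
Qed.

Lemma gaussian_cos_cvg (u_ : R^nat) (t_ : nat -> {nonneg R}) b v u a t :
  u_ @ \oo --> u -> (t_ n)%:num @[n --> \oo] --> t%:num ->
  gaussian_cos b v (u_ n) a (t_ n) @[n --> \oo] --> gaussian_cos b v u a t.
Proof.
move=> uu tt; apply: cvgM.
  apply: continuous_cvg; first exact: continuous_expR.
  apply: cvgN; apply: cvgMr_tmp; apply: cvgMr_tmp; apply: cvgM => //.
  by rewrite expr2; under eq_fun do rewrite expr2; exact: cvgM.
apply: continuous_cvg; first exact: continuous_cos.
by apply: cvgD; [apply: cvgMr_tmp; exact: cvgM|exact: cvg_cst].
Qed.

Definition nonneg_ratio (m n : nat) : {nonneg R} :=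
  NngNum (divr_ge0 (ler0n R m) (ler0n R n.+1)).

(** Countably many tests suffice: evenness of cosine handles negative frequencies and
    [cos_marginalE] the phases. Real frequencies are then reached at rational times, and real times
    last. *)
Lemma gaussian_marginals_ratio b v g : 0 <= v ->
  (forall k l m n, let u := (nonneg_ratio k l)%:num in let t := nonneg_ratio m n in
     cos_marginal u 0 t g = gaussian_cos b v u 0 t /\
     cos_marginal u (- (pi / 2)) t g = gaussian_cos b v u (- (pi / 2)) t) ->
  gaussian_marginals b v g.
Proof.
move=> v0 ratio; split => //.
suff pos u a t : 0 <= u -> cos_marginal u a t g = gaussian_cos b v u a t.
  move=> u a t; have [/pos ->//|u0] := leP 0 u.
  rewrite -cos_marginalN pos ?oppr_ge0 ?ltW// /gaussian_cos sqrrN.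
  by rewrite !mulNr -opprD cosN.
move=> u0.
suff base c : c = 0 \/ c = - (pi / 2) -> cos_marginal u c t g = gaussian_cos b v u c t.
  rewrite cos_marginalE !base; [|by right|by left].
  by rewrite /gaussian_cos cosBpihalf addr0 cosD; ring.
move=> c0.
pose approx (x : R) n := nonneg_ratio (Num.trunc (x * n.+1%:R)) n.
have approx_cvg x : 0 <= x -> (approx x n)%:num @[n --> \oo] --> x.
  by move=> x0; exact: cvg_trunc_div.
have freq m n : cos_marginal u c (nonneg_ratio m n) g =
    gaussian_cos b v u c (nonneg_ratio m n).
  have := cos_marginal_cvg_freq (a := c) (t := nonneg_ratio m n) (g := g)
    (approx_cvg _ u0).
  have -> : (fun l => cos_marginal (approx u l)%:num c (nonneg_ratio m n) g) =
      (fun l => gaussian_cos b v (approx u l)%:num c (nonneg_ratio m n)).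
    apply/funext => l; have [r1 r2] := ratio (Num.trunc (u * l.+1%:R)) l m n.
    by case: c0 => ->.
  move=> /cvg_unique; apply; first exact: Rhausdorff.
  by apply: gaussian_cos_cvg; [exact: approx_cvg|exact: cvg_cst].
have t0 : 0 <= t%:num by [].
have := cos_marginal_cvg_time (u := u) (a := c) (g := g) (approx_cvg _ t0).
have -> : (fun n => cos_marginal u c (approx t%:num n) g) =
    (fun n => gaussian_cos b v u c (approx t%:num n)).
  by apply/funext => n; exact: freq.
move=> /cvg_unique; apply; first exact: Rhausdorff.
by apply: gaussian_cos_cvg; [exact: cvg_cst|exact: approx_cvg].
Qed.

(** Since [drift] and [rate] are measurable functions of the law, the existential over parameters
    becomes a countable family of equations between measurable functions. *)
Lemma measurable_BM : measurable (BM R).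
Proof.
pose G u a t g := gaussian_cos (drift g) (rate g) u a t.
pose A (a : R) k l m n :=
  let u := (nonneg_ratio k l)%:num in let t := nonneg_ratio m n in
  [set g : levy_space R | cos_marginal u a t g = G u a t g].
have mA a k l m n : measurable (A a k l m n).
  apply: measurable_set_eq; first exact: measurable_cos_marginal.
  apply: measurable_funM.
    apply: measurableT_comp; first exact: measurable_expR.
    apply: measurable_funN; apply: measurable_funM => //.
    by apply: measurable_funM => //; exact: measurable_rate.
  apply: (measurableT_comp (bounded_mfun_cos _ _).1); exact: measurable_drift.
suff -> : BM R = \bigcap_k \bigcap_l \bigcap_m \bigcap_n
    (A 0 k l m n `&` A (- (pi / 2)) k l m n).
  do 4 (apply: bigcapT_measurable => ?).
  exact: measurableI.
apply/seteqP; split => g.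
  move=> /BM_gaussianP[b [v gbv]] k _ l _ m _ n _; rewrite /A /G /=.
  by rewrite (gaussian_rate gbv) (gaussian_drift gbv); split; exact: gbv.2.
move=> gA; apply/BM_gaussianP; exists (drift g), (rate g).
apply: gaussian_marginals_ratio; first exact: rate_ge0.
by move=> k l m n u t; have [] := gA k I l I m I n I.
Qed.

End brownian_laws.

(** * Mixtures of Brownian laws *)

Section damped_cosines.
Context {R : realType}.
Variables nu1 nu2 : probability (levy_space R) R.
Hypotheses (nu1BM : nu1 (BM R) = 1%E) (nu2BM : nu2 (BM R) = 1%E).
Hypothesis eq_marginals : forall (t : {nonneg R}) (f : R -> R), bounded_mfun f ->
  \int[nu1]_g marginal_int t f g = \int[nu2]_g marginal_int t f g.
Implicit Types (w s a : R) (g : levy_space R).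

Lemma eq_Rintegral_BM (nu : probability (levy_space R) R) (h k : levy_space R -> R) :
  nu (BM R) = 1%E -> measurable_fun setT h -> measurable_fun setT k ->
  (forall g, BM R g -> h g = k g) -> \int[nu]_g h g = \int[nu]_g k g.
Proof.
move=> nuBM mh mk hk; congr fine; apply: ae_eq_integral => //.
- exact/measurable_EFinP.
- exact/measurable_EFinP.
exists (~` BM R); split; first by apply: measurableC; exact: measurable_BM.
  by have := probability_setC nu (@measurable_BM R); rewrite nuBM subee.
by apply: subsetC => g BMg _; rewrite /= hk.
Qed.

(** This is [gaussian_cos] with u^2 t and u t freed into independent variables [w] and [s]: a real
    form of the joint Laplace-Fourier kernel in rate and drift. *)
Definition damped_cos w s a g : R :=
  expR (- (w * rate g / 2)) * cos (s * drift g + a).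

Lemma damped_cos_le1 w s a g : 0 <= w -> `|damped_cos w s a g| <= 1.
Proof.
move=> w0; rewrite normrM mulr_ile1// ?cos_max// ger0_norm ?expR_ge0//.
by rewrite -expR0 ler_expR oppr_le0 !mulr_ge0// rate_ge0.
Qed.

Lemma measurable_damped_cos w s a : measurable_fun setT (damped_cos w s a).
Proof.
apply: measurable_funM.
  apply: measurableT_comp; first exact: measurable_expR.
  apply: measurable_funN; apply: measurable_funM => //.
  by apply: measurable_funM => //; exact: measurable_rate.
by apply: (measurableT_comp (bounded_mfun_cos s a).1); exact: measurable_drift.
Qed.

Lemma bounded_mfun_damped_cos w s a : 0 <= w -> bounded_mfun (damped_cos w s a).
Proof.
move=> w0; split; first exact: measurable_damped_cos.
by exists 1 => g; exact: damped_cos_le1.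
Qed.

Lemma BM_cos_marginal u a (t : {nonneg R}) g : BM R g ->
  cos_marginal u a t g = damped_cos (u ^+ 2 * t%:num) (u * t%:num) a g.
Proof.
move=> /BM_gaussianP[b [v gbv]].
by rewrite gbv.2 /gaussian_cos /damped_cos (gaussian_rate gbv) (gaussian_drift gbv).
Qed.

Lemma eq_damped_cos_lim (w_ s_ : R^nat) w s a :
  (forall n, 0 <= w_ n) -> w_ @ \oo --> w -> s_ @ \oo --> s ->
  (forall n, \int[nu1]_g damped_cos (w_ n) (s_ n) a g =
             \int[nu2]_g damped_cos (w_ n) (s_ n) a g) ->
  \int[nu1]_g damped_cos w s a g = \int[nu2]_g damped_cos w s a g.
Proof.
move=> w0 ww ss E.
have cv (nu : probability (levy_space R) R) :
    \int[nu]_g damped_cos (w_ n) (s_ n) a g @[n --> \oo] -->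
    \int[nu]_g damped_cos w s a g.
  apply: (Rintegral_bounded_cvg (M := 1)).
  - by move=> n; exact: measurable_damped_cos.
  - by move=> n g; exact: damped_cos_le1.
  - move=> g; apply: cvgM.
      apply: continuous_cvg; first exact: continuous_expR.
      by apply: cvgN; apply: cvgMr_tmp; exact: cvgMr_tmp.
    apply: continuous_cvg; first exact: continuous_cos.
    by apply: cvgD; [exact: cvgMr_tmp|exact: cvg_cst].
have := cv nu1; rewrite (funext E) => /cvg_unique; apply; first exact: Rhausdorff.
exact: cv.
Qed.

(* The frequency [w / s] at time [s ^+ 2 / w] realizes every pair [(w, s)] with
   [0 < w] and [s != 0]; the remaining pairs are limits of those. *)
Lemma eq_damped_cos w s a : 0 <= w ->
  \int[nu1]_g damped_cos w s a g = \int[nu2]_g damped_cos w s a g.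
Proof.
have main w' s' : 0 < w' -> s' != 0 ->
    \int[nu1]_g damped_cos w' s' a g = \int[nu2]_g damped_cos w' s' a g.
  move=> w0 s0; pose t : {nonneg R} := NngNum (divr_ge0 (sqr_ge0 s') (ltW w0)).
  have E (nu : probability (levy_space R) R) : nu (BM R) = 1%E ->
      \int[nu]_g damped_cos w' s' a g = \int[nu]_g cos_marginal (w' / s') a t g.
    move=> nuBM; apply: eq_Rintegral_BM => //.
    - exact: measurable_damped_cos.
    - exact: measurable_cos_marginal.
    move=> g /BM_cos_marginal ->; have w'0 := lt0r_neq0 w0.
    have tE : t%:num = s' ^+ 2 / w' by [].
    rewrite (_ : (w' / s') ^+ 2 * t%:num = w'); last first.
      by rewrite tE; field; rewrite ?s0 ?w'0.
    by rewrite (_ : w' / s' * t%:num = s')// tE; field; rewrite ?s0 ?w'0.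
  rewrite !E//; apply: eq_marginals; exact: bounded_mfun_cos.
have inv_cvg0 : n.+1%:R^-1 @[n --> \oo] --> (0 : R) by exact: cvg_harmonic.
have pos w' s' : 0 < w' ->
    \int[nu1]_g damped_cos w' s' a g = \int[nu2]_g damped_cos w' s' a g.
  move=> w0; have [->|s0] := eqVneq s' 0; last exact: main.
  apply: (eq_damped_cos_lim (w_ := fun=> w') (s_ := fun n => n.+1%:R^-1)) => //.
  - by move=> n; exact: ltW.
  - exact: cvg_cst.
  - by move=> n; apply: main => //; rewrite invr_eq0.
move=> w0; apply: (eq_damped_cos_lim (w_ := fun n => w + n.+1%:R^-1) (s_ := fun=> s)).
- by move=> n; rewrite addr_ge0.
- by rewrite -[X in _ --> X]addr0; apply: cvgD => //; exact: cvg_cst.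
- exact: cvg_cst.
- by move=> n; apply: pos; rewrite ltr_wpDl.
Qed.

(** The leading factor is an accumulator. Multiplying it by the next factor adds the damping
    exponents and, by product-to-sum, yields half the sum of two damped cosines, each of which is a
    new accumulator. *)
Lemma eq_damped_cos_prod n (v s a : 'I_n -> R) w s0 a0 :
  (forall i, 0 <= v i) -> 0 <= w ->
  \int[nu1]_g (damped_cos w s0 a0 g * \prod_i damped_cos (v i) (s i) (a i) g) =
  \int[nu2]_g (damped_cos w s0 a0 g * \prod_i damped_cos (v i) (s i) (a i) g).
Proof.
elim: n v s a w s0 a0 => [|n IH] v s a w s0 a0 v0 w0.
  have E0 (nu : probability (levy_space R) R) :
      \int[nu]_g (damped_cos w s0 a0 g * \prod_i damped_cos (v i) (s i) (a i) g) =
      \int[nu]_g damped_cos w s0 a0 g.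
    by apply: eq_Rintegral => g _; rewrite big_ord0 mulr1.
  by rewrite !E0; exact: eq_damped_cos.
pose Q g := \prod_(i < n)
  damped_cos (v (lift ord0 i)) (s (lift ord0 i)) (a (lift ord0 i)) g.
have bQ : bounded_mfun Q.
  by apply: bounded_mfun_prod => i; exact: bounded_mfun_damped_cos.
have wv0 : 0 <= w + v ord0 by rewrite addr_ge0.
have bdQ s' a' : bounded_mfun (fun g => damped_cos (w + v ord0) s' a' g * Q g).
  by apply: bounded_mfunM => //; exact: bounded_mfun_damped_cos.
have E (nu : probability (levy_space R) R) :
    \int[nu]_g (damped_cos w s0 a0 g * \prod_i damped_cos (v i) (s i) (a i) g) =
    2^-1 * \int[nu]_g (damped_cos (w + v ord0) (s0 - s ord0) (a0 - a ord0) g * Q g) +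
    2^-1 * \int[nu]_g (damped_cos (w + v ord0) (s0 + s ord0) (a0 + a ord0) g * Q g).
  rewrite -[X in _ + X]RintegralZl//; last exact: bounded_mfun_integrable.
  rewrite -Rintegral_linear//; last first.
    by apply: bounded_mfunM => //; exact: bounded_mfun_cst.
  apply: eq_Rintegral => g _; rewrite big_ord_recl -/(Q g) /damped_cos.
  rewrite (_ : expR (- ((w + v ord0) * rate g / 2)) =
      expR (- (w * rate g / 2)) * expR (- (v ord0 * rate g / 2))); last first.
    by rewrite -expRD; congr expR; ring.
  rewrite (_ : (s0 - s ord0) * drift g + (a0 - a ord0) =
    (s0 * drift g + a0) - (s ord0 * drift g + a ord0)); last by ring.
  rewrite (_ : (s0 + s ord0) * drift g + (a0 + a ord0) =
    (s0 * drift g + a0) + (s ord0 * drift g + a ord0)); last by ring.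
  move: (s0 * _ + _) (s ord0 * _ + _) (expR _) (expR _) (Q g) => x y e1 e2 q.
  by rewrite cosB cosD; field.
by rewrite !E; congr (_ * _ + _ * _); apply: IH.
Qed.

(** By [eq_weighted_marginal_prod] only cosines need testing, and almost surely their marginal
    integrals are damped cosines. *)
Lemma eq_marginal_prod n (t : 'I_n -> {nonneg R}) (f : 'I_n -> R -> R) :
  (forall i, bounded_mfun (f i)) ->
  \int[nu1]_g (\prod_i marginal_int (t i) (f i) g) =
  \int[nu2]_g (\prod_i marginal_int (t i) (f i) g).
Proof.
move=> bf; have b1 : bounded_mfun (fun _ : levy_space R => 1 : R).
  exact: bounded_mfun_cst.
have := @eq_weighted_marginal_prod R nu1 nu2 n t _ _ b1 b1 _ f bf.
have E1 (nu : probability (levy_space R) R) h :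
    \int[nu]_g (1 * \prod_i marginal_int (t i) (h i) g) =
    \int[nu]_g (\prod_i marginal_int (t i) (h i) g).
  by apply: eq_Rintegral => g _; rewrite mul1r.
rewrite !E1; apply => u a.
have E (nu : probability (levy_space R) R) : nu (BM R) = 1%E ->
    \int[nu]_g (1 * \prod_i marginal_int (t i) (fun x => cos (u i * x + a i)) g) =
    (* [damped_cos 0 0 0] is the constant 1 and starts the accumulator. *)
    \int[nu]_g (damped_cos 0 0 0 g * \prod_i
       damped_cos (u i ^+ 2 * (t i)%:num) (u i * (t i)%:num) (a i) g).
  move=> nuBM; apply: eq_Rintegral_BM => //.
  - suff [] : bounded_mfun (fun g : levy_space R =>
      1 * \prod_i marginal_int (t i) (fun x => cos (u i * x + a i)) g) by [].
    apply: bounded_mfunM => //; apply: bounded_mfun_prod => i.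
    by apply: bounded_mfun_marginal_int; exact: bounded_mfun_cos.
  - suff [] : bounded_mfun (fun g => damped_cos 0 0 0 g * \prod_i
       damped_cos (u i ^+ 2 * (t i)%:num) (u i * (t i)%:num) (a i) g) by [].
    apply: bounded_mfunM; first exact: bounded_mfun_damped_cos.
    by apply: bounded_mfun_prod => i; apply: bounded_mfun_damped_cos;
      rewrite mulr_ge0// sqr_ge0.
  - move=> g BMg; congr (_ * _).
      by rewrite /damped_cos !mul0r oppr0 expR0 addr0 cos0 mulr1.
    by apply: eq_bigr => i _; exact: BM_cos_marginal.
rewrite !E//; apply: eq_damped_cos_prod => // i.
by rewrite mulr_ge0// sqr_ge0.
Qed.

End damped_cosines.

(** * Laws of paths *)

Section increments.
Context {R : realType}.
Implicit Types (t : nat -> {nonneg R}) (x : path_space R) (B : nat -> set R).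

(* Increments are counted from a fictitious value 0 at time 0, so that they
   determine the whole path, including its value at time 0. *)
Definition previous t j : {nonneg R} := if j is i.+1 then t i else 0%:nng.

Definition increment t j x : R := x (t j) - (if j is i.+1 then x (t i) else 0).

(** The absolute value provides the nonnegative type; along nondecreasing times it is the plain
    difference. *)
Definition lag t j : {nonneg R} :=
  (`|(t j)%:num - (previous t j)%:num|)%:nng.

Definition increment_box t n B : set (path_space R) :=
  [set x | forall j, (j < n)%N -> B j (increment t j x)].

Definition nondecreasing_times t :=
  forall i j, (i <= j)%N -> (t i)%:num <= (t j)%:num.

Lemma measurable_increment t j : measurable_fun setT (increment t j).
Proof.
apply: measurable_funB; first exact: (measurable_coord (t j)).
by case: j => [|i]; [exact: measurable_cst|exact: (measurable_coord (t i))].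
Qed.

Lemma measurable_increment_box t n B : (forall j, measurable (B j)) ->
  measurable (increment_box t n B).
Proof.
move=> mB; rewrite (_ : increment_box t n B =
    \bigcap_j (if (j < n)%N then increment t j @^-1` B j else setT)).
  apply: bigcapT_measurable => j; case: ifP => // _.
  by rewrite -[X in measurable X]setTI; exact: measurable_increment.
apply/seteqP; split => x xB j; first by move=> _; case: ifP => // /xB.
by have := xB j I; case: ifP.
Qed.

(** Independence factors the box, and stationarity turns each increment into a one-time marginal. *)
Lemma levy_increment_box d (T : measurableType d) (P : probability T R)
    (Z : process P) g t n B : levy_process Z -> has_law Z (law_of g) ->
  nondecreasing_times t -> (forall j, measurable (B j)) ->
  law_of g (increment_box t n B) = (\prod_(j < n) marginal (lag t j) g (B j))%E.
Proof.
move=> [Z0 Zstat Zindep _] Zg t_nd mB; rewrite Zg; last exact: measurable_increment_box.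
have p_nd i j : (i <= j)%N -> (previous t i)%:num <= (previous t j)%:num.
  case: i => [_|i]; last by case: j => // j ij; exact: (t_nd i j ij).
  by have : 0 <= (previous t j)%:num by [].
(* The time sequence used is 0, t 0, t 1, ..., whose [j]-th increment runs from [previous t j] to
   [t j]. *)
have := Zindep n (previous t) p_nd [set: 'I_n]%SET (fun j => B j) (fun j => mB j).
have incE j w : increment t j (trajectory Z w) = Z (t j) w - Z (previous t j) w.
  by case: j => [|j] //; rewrite /increment /previous Z0.
rewrite (_ : \bigcap_(j in _) _ = trajectory Z @^-1` increment_box t n B); last first.
  apply/seteqP; split => w /= wB j.
    by move=> jn; rewrite incE; apply: (wB (Ordinal jn)); rewrite /= finset.in_setT.
  by move=> _ /=; have := wB j (ltn_ord j); rewrite incE.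
move=> ->; rewrite big_mkcond/=; apply: eq_bigr => j _; rewrite finset.in_setT.
have lagE : ((previous t j)%:num + (lag t j)%:num)%:nng = t j.
  apply/val_inj; rewrite /= ger0_norm ?subr_ge0; first by rewrite addrC subrK.
  exact: (p_nd j j.+1).
pose z : {nonneg R} := NngNum (lexx 0).
have Zz w : Z z w = 0 by rewrite -[RHS](Z0 w); congr (Z _ w); exact/val_inj.
have lag0E : (z%:num + (lag t j)%:num)%:nng = lag t j.
  by apply/val_inj; rewrite /= add0r.
(* The increment is moved to start at time 0, where the process vanishes, leaving the value at time
   [lag t j]. *)
have := Zstat (previous t j) z (lag t j) (B j) (mB j).
rewrite lagE lag0E => Zlag.
transitivity (P [set w | B j (Z (lag t j) w - Z z w)]).
  exact: Zlag.
have mlag : measurable (coord (lag t j) @^-1` B j).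
  by rewrite -[X in measurable X]setTI; exact: measurable_coord.
transitivity (law_of g (coord (lag t j) @^-1` B j)); last by [].
rewrite Zg//; congr (P _); apply/seteqP.
by split => w /=; rewrite Zz subr0.
Qed.

End increments.

(** * Marginals and increment boxes of a mixture *)

Section mixtures.
Context {R : realType} {d} {T : measurableType d} {P : probability T R}.
Variables (nu : probability (levy_space R) R) (S : process P).
Hypothesis nuS : mixture nu S.

Lemma mixture_marginal t (B : set R) : measurable B ->
  (\int[nu]_g marginal_int t (\1_B) g)%:E = distribution P (S t) B.
Proof.
move=> mB; have bI := bounded_mfun_marginal_int t (bounded_mfun_indic mB).
rewrite /Rintegral fineK; last first.
  by apply: integrable_fin_num => //; exact: bounded_mfun_integrable.
transitivity (P (trajectory S @^-1` (coord t @^-1` B))); last by [].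
rewrite nuS; last by rewrite -[X in measurable X]setTI; exact: measurable_coord.
by apply: eq_integral => g _; exact: marginal_int_indic.
Qed.

(** A mixture need not have independent increments, but every component law does, so the
    factorization takes place under the integral. *)
Lemma mixture_increment_box (t : nat -> {nonneg R}) n (B : nat -> set R) :
  nondecreasing_times t -> (forall j, measurable (B j)) ->
  P (trajectory S @^-1` increment_box t n B) =
  (\int[nu]_g (\prod_(j < n) marginal_int (lag t j) (\1_(B j)) g))%:E.
Proof.
move=> t_nd mB.
have bI : bounded_mfun
    (fun g : levy_space R => \prod_(j < n) marginal_int (lag t j) (\1_(B j)) g).
  apply: bounded_mfun_prod => j; apply: bounded_mfun_marginal_int.
  exact: bounded_mfun_indic.
rewrite /Rintegral fineK; last first.
  by apply: integrable_fin_num => //; exact: bounded_mfun_integrable.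
rewrite nuS; last exact: measurable_increment_box.
apply: eq_integral => g _.
have [d' [T' [P' [Z [Zlevy Zg]]]]] := set_mem (valP g).
rewrite (levy_increment_box _ Zlevy Zg t_nd mB) -prodEFin.
by apply: eq_bigr => j _; rewrite marginal_int_indic.
Qed.

End mixtures.

Lemma measurable_trajectory {R : realType} d (T : measurableType d)
    (P : probability T R) (S : process P) : measurable_fun setT (trajectory S).
Proof.
apply: (@measurability _ _ T (path_space R) setT _ (@cylinders R)) => //.
move=> _ [_ [t _ [B mB <-]] <-].
rewrite setTI [X in measurable X](_ : _ = S t @^-1` B).
  by rewrite -[X in measurable X]setTI; exact: measurable_funP.
by apply/seteqP; split => w; [case|split].
Qed.

HB.instance Definition _ (R : realType) d (T : measurableType d)
    (P : probability T R) (S : process P) :=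
  isMeasurableFun.Build _ _ _ _ (trajectory S) (measurable_trajectory S).

(** * A path law is determined by its increment boxes *)

Section path_laws.
Context {R : realType}.
Variables mu1 mu2 : probability (path_space R) R.
Hypothesis eq_box : forall (t : nat -> {nonneg R}) n (B : nat -> set R),
  nondecreasing_times t -> (forall j, measurable (B j)) ->
  mu1 (increment_box t n B) = mu2 (increment_box t n B).

Definition increment_boxes (t : nat -> {nonneg R}) n : set (set (path_space R)) :=
  [set A | exists B : nat -> set R,
     (forall j, measurable (B j)) /\ A = increment_box t n B].

(** For fixed times the boxes form a pi-system containing the whole space. *)
Lemma eq_increment_sigma (t : nat -> {nonneg R}) n : nondecreasing_times t ->
  forall A, <<s increment_boxes t n >> A -> mu1 A = mu2 A.
Proof.
move=> t_nd.
apply: (g_sigma_algebra_measure_unique (increment_boxes t n) _ (fun=> setT)).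
- by move=> _ [B [mB ->]]; exact: measurable_increment_box.
- by move=> k; exists (fun=> setT); split => //; apply/seteqP; split.
- by apply/seteqP; split => // x _; exists 0%N.
- move=> _ _ [B [mB ->]] [C [mC ->]]; exists (fun j => B j `&` C j).
  split; first by move=> j; exact: measurableI.
  apply/seteqP; split => x.
    by move=> [xB xC] j jn; split; [exact: xB|exact: xC].
  by move=> xBC; split => j /xBC[].
- by move=> _ [B [mB ->]]; exact: eq_box.
- by move=> k; rewrite (le_lt_trans (probability_le1 mu1 measurableT))// ltry.
Qed.

(** Telescoping: each coordinate is the sum of the increments up to it, the first of which is the
    first coordinate itself. *)
Lemma coord_increment_sigma (t : nat -> {nonneg R}) n j (B : set R) :
  (j < n)%N -> measurable B ->
  <<s increment_boxes t n >> (coord (t j) @^-1` B).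
Proof.
pose U := g_sigma_algebraType (increment_boxes t n).
have minc i : (i < n)%N -> measurable_fun setT (increment t i : U -> R).
  move=> lin _ C mC; rewrite setTI; apply: sub_sigma_algebra.
  exists (fun k => if k == i then C else setT); split.
    by move=> k; case: ifP.
  apply/seteqP; split => x /=.
    by move=> xC k kn; case: eqP => // ->.
  by move=> /(_ i lin); rewrite eqxx.
have mcoord i : (i < n)%N -> measurable_fun setT (coord (t i) : U -> R).
  elim: i => [|i IH] lin.
    by have := minc 0%N lin; congr measurable_fun; apply/funext => x;
      rewrite /increment subr0.
  have := measurable_funD (minc _ lin) (IH (ltnW lin)).
  by congr measurable_fun; apply/funext => x; rewrite /increment /= subrK.
by move=> jn mB; have := mcoord j jn measurableT B mB; rewrite setTI.
Qed.

(** The list of times may be unordered and repeat entries, so that intersecting cylinders is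
    concatenating lists. *)
Inductive finite_cylinder : seq {nonneg R} -> set (path_space R) -> Prop :=
| finite_cylinder_nil : finite_cylinder [::] setT
| finite_cylinder_cons t s B A : measurable B -> finite_cylinder s A ->
    finite_cylinder (t :: s) (coord t @^-1` B `&` A).

Lemma finite_cylinderI s1 s2 A1 A2 : finite_cylinder s1 A1 ->
  finite_cylinder s2 A2 -> finite_cylinder (s1 ++ s2) (A1 `&` A2).
Proof.
move=> c1 c2; elim: c1 => [|t s B A mB cA IH]; first by rewrite setTI.
by rewrite -setIA; exact: finite_cylinder_cons.
Qed.

Lemma finite_cylinder_sigma (t : nat -> {nonneg R}) n s A :
  finite_cylinder s A -> (forall u, u \in s -> exists2 j, (j < n)%N & t j = u) ->
  <<s increment_boxes t n >> A.
Proof.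
elim=> [_|u s' B A' mB _ IH st].
  exact: (@measurableT _ (g_sigma_algebraType (increment_boxes t n))).
apply: (@measurableI _ (g_sigma_algebraType (increment_boxes t n))).
  by have [|j jn <-] := st u; [exact: mem_head|exact: coord_increment_sigma].
by apply: IH => x xs; apply: st; rewrite in_cons xs orbT.
Qed.

Lemma eq_finite_cylinder s A : finite_cylinder s A -> mu1 A = mu2 A.
Proof.
move=> cA; pose r := sort <=%O s.
(* The sorted list is continued by its last entry, keeping the infinite sequence nondecreasing; for
   an empty list it is constantly the default 0. *)
pose t j : {nonneg R} := nth (NngNum (lexx 0)) r (minn j (size r).-1).
have t_nd : nondecreasing_times t.
  move=> i j ij; have [r0|r0] := posnP (size r).
    by rewrite /t (size0nil r0) !nth_nil.
  have rP k : minn k (size r).-1 \in [pred n | (n < size r)%N].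
    by rewrite inE (leq_ltn_trans (geq_minr _ _))// prednK.
  have := sorted_leq_nth le_trans lexx (NngNum (lexx 0)) (sort_le_sorted s)
    _ _ (rP i) (rP j).
  by apply; rewrite leq_min geq_minr andbT (leq_trans (geq_minl _ _)).
apply: (eq_increment_sigma (n := size r) t_nd).
apply: finite_cylinder_sigma cA _ => u us; exists (index u r).
  by rewrite index_mem mem_sort.
have ur : (index u r < size r)%N by rewrite index_mem mem_sort.
rewrite /t (minn_idPl _) ?nth_index ?mem_sort//.
by rewrite -ltnS prednK// (leq_ltn_trans _ ur).
Qed.

(** Finite cylinders form a pi-system that generates the product sigma-algebra; the empty list
    supplies the whole space. *)
Lemma eq_path_law A : measurable A -> mu1 A = mu2 A.
Proof.
pose G := [set A | exists s, finite_cylinder s A].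
have mG : @measurable _ (path_space R) = <<s G >>.
  apply/seteqP; split.
    apply: smallest_sub; first exact: smallest_sigma_algebra.
    move=> _ [t _ [B mB <-]]; apply: sub_sigma_algebra; exists [:: t].
    by rewrite setIC; apply: finite_cylinder_cons => //; exact: finite_cylinder_nil.
  apply: smallest_sub; first exact: sigma_algebra_measurable.
  move=> B [s cB]; elim: cB => // t s' C B' mC _ mB'; apply: measurableI => //.
  by rewrite -[X in measurable X]setTI; exact: measurable_coord.
apply: (measure_unique G (fun=> setT)) => //.
- by move=> A1 A2 [s1 c1] [s2 c2]; exists (s1 ++ s2); exact: finite_cylinderI.
- by move=> k; exists [::]; exact: finite_cylinder_nil.
- by apply/seteqP; split => // x _; exists 0%N.
- by move=> B [s]; exact: eq_finite_cylinder.
- by move=> k; rewrite (le_lt_trans (probability_le1 mu1 measurableT))// ltry.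
Qed.

End path_laws.

Theorem proposition3p1p1 (R : realType) : good (BM R).
Proof.
split; first exact: measurable_BM.
move=> nu1 nu2 d1 T1 P1 S1 d2 T2 P2 S2 nuS1 nu1BM nuS2 nu2BM eqS A mA.
(* On indicators this is the assumed equality of the one-time laws of [S1] and [S2]. *)
have eq_marginals t f : bounded_mfun f ->
    \int[nu1]_g marginal_int t f g = \int[nu2]_g marginal_int t f g.
  apply: eq_Rintegral_marginal_int => B mB; apply: EFin_inj.
  by rewrite (mixture_marginal nuS1)// (mixture_marginal nuS2)// eqS.
(* The image laws on path space are compared on increment boxes, where both are mixed products of
   marginals. *)
apply: (@eq_path_law R (distribution P1 (trajectory S1))
  (distribution P2 (trajectory S2))) => // t n B t_nd mB.
transitivity (P1 (trajectory S1 @^-1` increment_box t n B)); first by [].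
transitivity (P2 (trajectory S2 @^-1` increment_box t n B)); last by [].
rewrite (mixture_increment_box nuS1)// (mixture_increment_box nuS2)//.
congr EFin; apply: eq_marginal_prod => // j; exact: bounded_mfun_indic.
Qed.
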